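(* Let $I\subset\mathbb R$ be a half-line. If $g\colon I\to I$ is a continuous function satisfying $$g^3(x)=3g(x)-2x\quad\text{for every }x\in I,$$ then there exists $c\in\mathbb R$ such that $$g(x)=x+c\quad\text{for every }x\in I.$$ Moreover, $c\le 0$ in the case where $\inf I=-\infty$, and $c\ge 0$ in the case where $\sup I=+\infty$.
   Context: For a self-mapping $g\colon I\to I$, $g^n$ denotes the $n$-th iterate of $g$: $g^0=\mathrm{id}_I$ and $g^k=g\circ g^{k-1}$ for all integers $k\ge 1$ (so $g^3=g\circ g\circ g$). A half-line is an interval (open or closed at its finite endpoint) with exactly one of its endpoints infinite, i.e. of the form $(a,+\infty)$, $[a,+\infty)$, $(-\infty,a)$ or $(-\infty,a]$ with $a\in\mathbb R$. *)

(* Defs.v *)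
From HB Require Import structures.
From mathcomp Require Import all_boot all_order all_algebra.
From mathcomp Require Import all_classical all_reals all_analysis.
Set Implicit Arguments.
Unset Strict Implicit.
Unset Printing Implicit Defensive.
Import Order.TTheory GRing.Theory Num.Theory.
Import numFieldNormedType.Exports.

Local Open Scope classical_set_scope.
Local Open Scope ring_scope.

Definition half_line (R : realType) (I : set R) : Prop :=
  exists a : R, [\/ I = `]a, +oo[%classic, I = `[a, +oo[%classic,
                    I = `]-oo, a[%classic | I = `]-oo, a]%classic].

(* Main.v *)
(* The characteristic polynomial of the recurrence is (r - 1)^2 (r + 2), so an
   orbit has the form A + B n + C (-2)^n. On a half-line bounded on one side
   the oscillating term must vanish and B has a fixed sign, so every orbit is an
   arithmetic progression with step B(x) = g x - x. The equation makes g
   injective, hence strictly increasing; comparing the iterates at x < y gives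
   B(x) <= B(y), and if B(x) > 0 the orbit of x passes y, whence equality. Thus
   B takes at most one nonzero value, and continuity makes it constant.
   Half-lines unbounded below are treated by conjugating g with -x. *)
Require Import Defs.
From HB Require Import structures.
From mathcomp Require Import all_boot all_order all_algebra.
From mathcomp Require Import all_classical all_reals all_analysis.
From mathcomp Require Import ring lra.
Set Implicit Arguments.
Unset Strict Implicit.
Unset Printing Implicit Defensive.
Import Order.TTheory GRing.Theory Num.Theory.
Import numFieldNormedType.Exports.

Local Open Scope classical_set_scope.
Local Open Scope ring_scope.

(** * Real sequences satisfying the recurrence and bounded below *)

(** Exponential growth beats linear growth. The base is 4 = (-2)^2, so that the oscillating term can
    be tested along even and odd indices separately. *)
Lemma exp4_linear_bound (R : realType) (k p q : R) :
  (forall m : nat, k * 4 ^+ m <= p + q * m%:R) -> k <= 0.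
Proof.
move=> H; rewrite leNgt; apply/negP => k0.
have exp4_ge (m : nat) : m%:R ^+ 2 <= 4 ^+ m :> R.
  case: m => [|m]; first by rewrite expr0n.
  elim: m => [|m IH]; first by rewrite !expr1; lra.
  have m0 : 0 <= m%:R :> R by [].
  rewrite exprS; apply: le_trans (_ : 4 * m.+1%:R ^+ 2 <= _); last first.
    by rewrite ler_pM2l.
  by rewrite -(addn1 m.+1) -(addn1 m) !natrD; nra.
(* For m > b and m >= 1, k m^2 > (|p| + |q|) m >= p + q m, while k m^2 <= k 4^m. *)
pose b := (`|p| + `|q|) / k.
have b0 : 0 <= b by rewrite divr_ge0 ?addr_ge0 // ltW.
have := archi_boundP b0; set m := Num.bound b => bm.
have {bm} km : `|p| + `|q| < k * m%:R by rewrite mulrC -ltr_pdivrMr.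
have m1 : 1 <= m%:R :> R.
  rewrite ler1n lt0n; apply/eqP => m0; move: km.
  by rewrite m0 mulr0 ltNge addr_ge0.
have H1 := H m; have H2 := exp4_ge m.
have Hp := ler_norm p; have Hq := ler_norm q.
have p0 := normr_ge0 p; have q0 := normr_ge0 q.
have H3 : k * m%:R ^+ 2 <= k * 4 ^+ m by rewrite ler_pM2l.
by nra.
Qed.

(** The second difference kills A + B n and multiplies (-2)^n by (-3)^2 = 9, which gives [c] as the
    coefficient of (-2)^n. *)
Lemma recurrence_closed_form (R : realType) (u : nat -> R) (n : nat) :
  (forall n, u n.+3 = 3 * u n.+1 - 2 * u n) ->
  let c := (u 2 - 2 * u 1%N + u 0) / 9 in
  u n = u 0 - c + n%:R * (u 1%N - u 0 + 3 * c) + c * (- 2) ^+ n.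
Proof.
move=> rec c.
pose v n := u 0 - c + n%:R * (u 1%N - u 0 + 3 * c) + c * (- 2) ^+ n.
suff: [/\ u n = v n, u n.+1 = v n.+1 & u n.+2 = v n.+2] by case.
elim: n => [|n [H0 H1 H2]].
  by split; rewrite /v /c; field.
split=> //; rewrite rec H0 H1 /v !exprS.
rewrite -(addn3 n) -(addn1 n) !natrD; ring.
Qed.

Lemma recurrence_bounded_below (R : realType) (u : nat -> R) (a : R) :
  (forall n, u n.+3 = 3 * u n.+1 - 2 * u n) -> (forall n, a <= u n) ->
  u 0 <= u 1%N /\ forall n, u n = u 0 + n%:R * (u 1%N - u 0).
Proof.
move=> rec ua; have := fun n => recurrence_closed_form n rec.
set c := _ / 9 => /= uE.
have m2E (m : nat) : (- 2) ^+ (2 * m) = 4 ^+ m :> R.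
  by rewrite exprM; congr (_ ^+ m); ring.
(* Even indices bound [c] from below and odd ones from above. *)
have cN : - c <= 0.
  apply: (@exp4_linear_bound _ _ (u 0 - c - a) (2 * (u 1%N - u 0 + 3 * c))).
  by move=> m; have := ua (2 * m)%N; rewrite uE m2E natrM; lra.
have cP : 2 * c <= 0.
  apply: (@exp4_linear_bound _ _ (u 0 - c - a + (u 1%N - u 0 + 3 * c))
    (2 * (u 1%N - u 0 + 3 * c))).
  move=> m; have := ua (2 * m).+1.
  by rewrite uE exprS m2E -addn1 natrD natrM; lra.
have c0 : c = 0 by lra.
have {}uE n : u n = u 0 + n%:R * (u 1%N - u 0) by rewrite uE c0; ring.
split=> //.
suff : u 0 - u 1%N <= 0 by lra.
(* Sampling at index 4^m turns linear growth into the exponential growth that the bound handles. *)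
apply: (@exp4_linear_bound _ _ (u 0 - a) 0) => m.
rewrite mul0r addr0; have := ua (4 ^ m)%N; rewrite uE natrX; lra.
Qed.

(** * Upward closed intervals bounded below, open or closed at the endpoint *)

Section UpwardClosed.
Variables (R : realType) (i : interval R) (g : R -> R) (a : R).
Hypothesis i_ge : forall x, x \in i -> a <= x.
Hypothesis i_up : forall x y, x \in i -> x <= y -> y \in i.
Hypothesis gi : forall x, x \in i -> g x \in i.
Hypothesis gcont : {within [set` i], continuous g}.
Hypothesis geq : forall x, x \in i -> iter 3 g x = 3 * g x - 2 * x.

Lemma iter_mem n x : x \in i -> iter n g x \in i.
Proof. by move=> ix; elim: n => //= n; exact: gi. Qed.

Lemma iter_affine x : x \in i ->
  x <= g x /\ forall n, iter n g x = x + n%:R * (g x - x).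
Proof.
move=> ix; apply: (@recurrence_bounded_below _ (fun n => iter n g x) a).
  by move=> n; rewrite -(geq (iter_mem n ix)).
by move=> n; exact/i_ge/iter_mem.
Qed.

(** The equation recovers x from g x, as 2 x = 3 g x - g (g (g x)). *)
Lemma g_inj : {in i &, injective g}.
Proof.
move=> x y ix iy gxy; have := geq ix; have := geq iy.
by rewrite /= gxy => ->; lra.
Qed.

Lemma g_incr : {in i &, {homo g : x y / x < y}}.
Proof.
have [//|gdecr] := itv_continuous_inj_mono gcont g_inj.
move=> x y ix iy xy; exfalso.
(* A decreasing g gives g z < g x < z, contradicting z <= g z. *)
pose z := Num.max y (g x) + 1.
have yz : y < z by rewrite ltr_pwDr // le_max lexx.
have gxz : g x < z by rewrite ltr_pwDr // le_max lexx orbT.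
have iz : z \in i by exact: i_up iy (ltW yz).
have := gdecr _ _ iz ix (lt_trans xy yz); have [] := iter_affine iz.
by move: gxz; lra.
Qed.

Lemma iter_incr n : {in i &, {homo iter n g : x y / x < y}}.
Proof.
move=> x y ix iy xy; elim: n => //= n; apply: g_incr; exact: iter_mem.
Qed.

(** Order is preserved by all iterates, so a larger step at x would let its orbit overtake that of
    y. *)
Lemma shift_nondecreasing x y : x \in i -> y \in i -> x < y ->
  g x - x <= g y - y.
Proof.
move=> ix iy xy; rewrite -subr_le0.
apply: (@exp4_linear_bound _ _ (y - x) 0) => m.
have := iter_incr (4 ^ m) ix iy xy.
by rewrite (iter_affine ix).2 (iter_affine iy).2 natrX; nra.
Qed.

(* The orbit of x keeps the shift g x - x and passes y. *)
Lemma shift_eq x y : x \in i -> y \in i -> x < y -> x < g x ->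
  g x - x = g y - y.
Proof.
move=> ix iy xy gx.
have gx0 : 0 < g x - x by rewrite subr_gt0.
have b0 : 0 <= (y - x) / (g x - x) by rewrite divr_ge0 // subr_ge0 ltW.
have := archi_boundP b0; set n := Num.bound _.
rewrite ltr_pdivrMr // => yn.
have yz : y < iter n g x by rewrite (iter_affine ix).2; lra.
have := shift_nondecreasing iy (iter_mem n ix) yz.
have -> : g (iter n g x) = iter n.+1 g x by [].
rewrite !(iter_affine ix).2 -addn1 natrD.
by have := shift_nondecreasing ix iy xy; lra.
Qed.

Lemma shift_constant x y : x \in i -> y \in i -> g x - x = g y - y.
Proof.
wlog xy : x y / x < y.
  move=> H ix iy; have [xy|yx|->//] := ltgtP x y; first exact: H.
  by apply/esym/H.
move=> ix iy; have [gx _] := iter_affine ix.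
have [|gxx] := ltP x (g x); first exact: shift_eq.
have [gy _] := iter_affine iy.
have [ygy|gyy] := ltP y (g y); last by lra.
have cont : {within `[x, y], continuous (g \- id)}.
  apply: within_continuousB; last first.
    by apply: continuous_subspaceT => t; exact: cvg_id.
  apply: continuous_subspaceW gcont => z /=.
  by rewrite in_itv /= => /andP[xz _]; exact: i_up ix xz.
(* Here the shift is 0 at x and positive at y. A point z with half the shift of y would, by
   [shift_eq], have the same shift as y. *)
have [|z zxy /= gz] := @IVT _ (g \- id) x y ((g y - y) / 2) (ltW xy) cont.
  rewrite ge_min le_max /=; apply/andP; split; apply/orP; [left|right]; lra.
move: zxy; rewrite in_itv /= => /andP[xz zy].
have iz := i_up ix xz.
have zy' : z < y.
  rewrite lt_neqAle zy andbT; apply/eqP => zyE; move: gz; rewrite zyE; lra.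
have := shift_eq iz iy zy'; lra.
Qed.

End UpwardClosed.

Lemma upward_closed_translation (R : realType) (i : interval R) (g : R -> R)
    (a x0 : R) :
  x0 \in i -> (forall x, x \in i -> a <= x) ->
  (forall x y, x \in i -> x <= y -> y \in i) ->
  (forall x, x \in i -> g x \in i) -> {within [set` i], continuous g} ->
  (forall x, x \in i -> iter 3 g x = 3 * g x - 2 * x) ->
  exists c, 0 <= c /\ forall x, x \in i -> g x = x + c.
Proof.
move=> ix0 i_ge i_up gi gcont geq; exists (g x0 - x0); split.
  by rewrite subr_ge0; have [] := iter_affine i_ge gi geq ix0.
by move=> x ix; rewrite (shift_constant i_ge i_up gi gcont geq ix0 ix); ring.
Qed.

(** * Reflection to intervals unbounded below *)

Lemma within_continuous_oppr_conj (R : realType) (A : set R) (f : R -> R) :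
  {within A, continuous f} ->
  {within -%R @^-1` A, continuous (fun x => - f (- x))}.
Proof.
move=> /subspace_continuousP cf; apply/subspace_continuousP => x /= Ax.
apply: cvgN; apply: (@cvg_comp _ _ _ -%R f); last exact: cf Ax.
move=> B /= AB; exact: (@oppr_continuous _ _ x _ AB).
Qed.

(** The equation is linear with odd terms, so it survives conjugation by x -> -x, which negates the
    shift. [j] is the mirror image of [i]. *)
Lemma downward_closed_translation (R : realType) (i j : interval R)
    (g : R -> R) (a x0 : R) :
  (forall x, (x \in j) = (- x \in i)) ->
  x0 \in i -> (forall x, x \in i -> x <= a) ->
  (forall x y, x \in i -> y <= x -> y \in i) ->
  (forall x, x \in i -> g x \in i) -> {within [set` i], continuous g} ->
  (forall x, x \in i -> iter 3 g x = 3 * g x - 2 * x) ->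
  exists c, c <= 0 /\ forall x, x \in i -> g x = x + c.
Proof.
move=> jE ix0 i_le i_down gi gcont geq.
have [|||||x jx|c [c0 gE]] :=
  @upward_closed_translation R j (fun x => - g (- x)) (- a) (- x0).
- by rewrite jE opprK.
- by move=> x; rewrite jE lerNl; exact: i_le.
- by move=> x y; rewrite !jE => ix xy; apply: i_down ix _; rewrite lerN2.
- by move=> x; rewrite !jE opprK; exact: gi.
- have -> : [set` j] = -%R @^-1` [set` i] by apply/seteqP; split=> x /=; rewrite jE.
  exact: within_continuous_oppr_conj.
- have := @geq (- x); rewrite -jE => /(_ jx) /=; rewrite !opprK => ->; ring.
exists (- c); split; first by rewrite oppr_le0.
by move=> x ix; have := gE (- x); rewrite jE opprK => /(_ ix); lra.
Qed.

(** Makes the sign clause at the bounded end of the half-line vacuous. *)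
Lemma ereal_inf_EFin_lbound (R : realType) (A : set R) (a : R) :
  (forall x, A x -> a <= x) -> ereal_inf (EFin @` A) <> -oo%E.
Proof.
move=> Aa infA; have : (a%:E <= ereal_inf (EFin @` A))%E.
  by apply: le_ereal_inf_tmp => _ [x Ax <-]; rewrite lee_fin; exact: Aa.
by rewrite infA.
Qed.

Lemma ereal_sup_EFin_ubound (R : realType) (A : set R) (a : R) :
  (forall x, A x -> x <= a) -> ereal_sup (EFin @` A) <> +oo%E.
Proof.
move=> Aa supA; have : (ereal_sup (EFin @` A) <= a%:E)%E.
  by apply: ge_ereal_sup => _ [x Ax <-]; rewrite lee_fin; exact: Aa.
by rewrite supA.
Qed.

(* A self-map of I is represented by a function on R mapping I into I; its
   values outside I are irrelevant. *)
Theorem theorem3p2 (R : realType) (I : set R) (g : R -> R)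
  (hI : half_line I)
  (gI : forall x : R, I x -> I (g x))
  (gcont : {within I, continuous g})
  (geq : forall x : R, I x -> iter 3 g x = 3 * g x - 2 * x) :
  exists c : R,
    [/\ forall x : R, I x -> g x = x + c,
        ereal_inf (EFin @` I) = -oo%E -> c <= 0
      & ereal_sup (EFin @` I) = +oo%E -> 0 <= c].
Proof.
have [a Ia] := hI.
have upward (i : interval R) (x0 : R) : I = [set` i] -> x0 \in i ->
    (forall x, x \in i -> a <= x) ->
    (forall x y, x \in i -> x <= y -> y \in i) ->
    exists c : R, [/\ forall x : R, I x -> g x = x + c,
      ereal_inf (EFin @` I) = -oo%E -> c <= 0
    & ereal_sup (EFin @` I) = +oo%E -> 0 <= c].
  move=> IE ix0 i_ge i_up; move: gI gcont geq; rewrite IE => gi cg eqg.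
  have [c [c0 gE]] := upward_closed_translation ix0 i_ge i_up gi cg eqg.
  by exists c; split=> // /(ereal_inf_EFin_lbound i_ge).
have downward (i j : interval R) (x0 : R) : I = [set` i] ->
    (forall x, (x \in j) = (- x \in i)) -> x0 \in i ->
    (forall x, x \in i -> x <= a) ->
    (forall x y, x \in i -> y <= x -> y \in i) ->
    exists c : R, [/\ forall x : R, I x -> g x = x + c,
      ereal_inf (EFin @` I) = -oo%E -> c <= 0
    & ereal_sup (EFin @` I) = +oo%E -> 0 <= c].
  move=> IE jE ix0 i_le i_down; move: gI gcont geq; rewrite IE => gi cg eqg.
  have [c [c0 gE]] := downward_closed_translation jE ix0 i_le i_down gi cg eqg.
  by exists c; split=> // /(ereal_sup_EFin_ubound i_le).
case: Ia => IE.
(* The point a + 1 lies in the half-line whether or not a does; a - 1 serves likewise below. *)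
- apply: (upward _ (a + 1) IE); rewrite ?in_itv /= ?andbT; first by lra.
    by move=> x; rewrite in_itv /= andbT; exact: ltW.
  by move=> x y; rewrite !in_itv /= !andbT; exact: lt_le_trans.
- apply: (upward _ (a + 1) IE); rewrite ?in_itv /= ?andbT; first by lra.
    by move=> x; rewrite in_itv /= andbT.
  by move=> x y; rewrite !in_itv /= !andbT; exact: le_trans.
- apply: (downward _ `]- a, +oo[ (a - 1) IE); rewrite ?in_itv /=.
  + by move=> x; rewrite !in_itv /= andbT ltrNl.
  + by lra.
  + by move=> x; rewrite in_itv /=; exact: ltW.
  + by move=> x y; rewrite !in_itv /= => xa yx; exact: le_lt_trans xa.
- apply: (downward _ `[- a, +oo[ (a - 1) IE); rewrite ?in_itv /=.
  + by move=> x; rewrite !in_itv /= andbT lerNl.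
  + by lra.
  + by move=> x; rewrite in_itv /=.
  + by move=> x y; rewrite !in_itv /= => xa yx; exact: le_trans xa.
Qed.
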